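(* Let $(X,\mathcal{A},\mu)$ be a measure space and let $I$ be an ideal of the ring $\mathcal{M}(X,\mathcal{A})$. The following statements are equivalent. (1) The $U_{\mu_I}$-topology equals the $m_{\mu_I}$-topology on $\mathcal{M}(X,\mathcal{A})$. (2) $\mathcal{M}(X,\mathcal{A})$ with the $U_{\mu_I}$-topology is a topological ring. (3) $\mathcal{M}(X,\mathcal{A})$ with the $U_{\mu_I}$-topology is a topological vector space. (4) $L_I^\infty(\mu)=\mathcal{M}(X,\mathcal{A})$. (5) $I\mu(X,\mathcal{A})=L_I^\infty(\mu)$. (6) $I\mu(X,\mathcal{A})=\mathcal{M}(X,\mathcal{A})$. (7) $\mathcal{M}(X,\mathcal{A})$ with the $U_{\mu_I}$-topology is connected. (8) $Z[I]$ is a $\mu$-stable family.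
   Context: $X$ is a non-empty set, $\mathcal{A}$ a $\sigma$-algebra on $X$, and $\mu:\mathcal{A}\to[0,\infty]$ a measure. $\mathcal{M}(X,\mathcal{A})$ is the commutative ring with unity (and real vector space) of all real-valued $\mathcal{A}$-measurable functions on $X$, with pointwise operations. For $g\in\mathcal{M}(X,\mathcal{A})$, $Z(g)=\{x\in X: g(x)=0\}$, and for an ideal $I$, $Z[I]=\{Z(g): g\in I\}$. Null sets $E$ below are always members of $\mathcal{A}$. $L_I^\infty(\mu)$ is the set of all $f\in\mathcal{M}(X,\mathcal{A})$ for which there exist $Z\in Z[I]$ and $E\subseteq Z$ with $\mu(E)=0$ such that $f$ is bounded on $Z\setminus E$. $I\mu(X,\mathcal{A})$ is the set of all $f\in\mathcal{M}(X,\mathcal{A})$ such that for every $g\in\mathcal{M}(X,\mathcal{A})$ there exist $Z\in Z[I]$ and $E\subseteq Z$ with $\mu(E)=0$ such that $fg$ is bounded on $Z\setminus E$. $Z[I]$ is $\mu$-stable if for every $f\in\mathcal{M}(X,\mathcal{A})$ there exist $Z\in Z[I]$ and $E\subseteq Z$ with $\mu(E)=0$ such that $f$ is bounded on $Z\setminus E$. $U_{\mu_I}^+$ is the set of all $u\in\mathcal{M}(X,\mathcal{A})$ for which there exist $Z\in Z[I]$ and $E\subseteq Z$ with $\mu(E)=0$ such that $u(x)>0$ for all $x\in Z\setminus E$. For $f\in\mathcal{M}(X,\mathcal{A})$ and $u\in U_{\mu_I}^+$, $m_{\mu_I}(f,u)$ is the set of all $g\in\mathcal{M}(X,\mathcal{A})$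 for which there exist $Z\in Z[I]$ and $E\subseteq Z$ with $\mu(E)=0$ such that $|g(x)-f(x)|<u(x)$ for all $x\in Z\setminus E$. The sets $m_{\mu_I}(f,u)$ form an open base for a topology on $\mathcal{M}(X,\mathcal{A})$, called the $m_{\mu_I}$-topology. For $f\in\mathcal{M}(X,\mathcal{A})$ and real $\epsilon>0$, $U_{\mu_I}(f,\epsilon)$ is the set of all $g\in\mathcal{M}(X,\mathcal{A})$ such that $\sup_{x\in Z\setminus E}|f(x)-g(x)|<\epsilon$ for some $Z\in Z[I]$ and some $E\subseteq Z$ with $\mu(E)=0$ (the supremum is taken in $[0,\infty]$). The sets $U_{\mu_I}(f,\epsilon)$ form an open base for a topology on $\mathcal{M}(X,\mathcal{A})$, called the $U_{\mu_I}$-topology. Topological rings and topological vector spaces (over $\mathbb{R}$) are not required to be Hausdorff. *)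

(* Defs.v *)
From HB Require Import structures.
From mathcomp Require Import all_boot all_order all_algebra.
From mathcomp Require Import all_classical all_reals all_analysis.
From mathcomp Require Import measurable_realfun.

Set Implicit Arguments.
Unset Strict Implicit.
Unset Printing Implicit Defensive.

Import Order.TTheory GRing.Theory Num.Theory.
Import numFieldNormedType.Exports.

Local Open Scope classical_set_scope.
Local Open Scope ring_scope.

(* Ideals of a commutative ring. The library's [idealr] is restricted to proper
   ideals; here the whole ring is allowed. *)
Record ideal (A : comNzRingType) := Ideal {
  ideal_set :> set A ;
  ideal0 : ideal_set 0 ;
  idealD : forall f g, ideal_set f -> ideal_set g -> ideal_set (f + g) ;
  idealMl : forall a f, ideal_set f -> ideal_set (a * f)
}.

Definition zero_set (T : Type) (R : realType) (g : T -> R) : set T :=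
  [set x | g x = 0].

Definition zero_sets d (T : measurableType d) (R : realType)
    (I : ideal {mfun T >-> R}) : set (set T) :=
  [set zero_set g | g in (I : set {mfun T >-> R})].

(* [P] holds of [Z \ E] for some member [Z] of the family [F] and some
   measurable [E] contained in [Z] with [mu E = 0]. *)
Definition on_conull d (T : measurableType d) (R : realType)
    (mu : {measure set T -> \bar R}) (F : set (set T)) (P : set T -> Prop) :=
  exists Z E : set T,
    [/\ F Z, E `<=` Z, measurable E, mu E = 0%E & P (Z `\` E)].

Definition mu_stable d (T : measurableType d) (R : realType)
    (mu : {measure set T -> \bar R}) (F : set (set T)) : Prop :=
  forall f : {mfun T >-> R},
    on_conull mu F (fun A => [bounded f x | x in A]).

Section measure_ideal.
Context d (T : measurableType d) (R : realType).
Variables (mu : {measure set T -> \bar R}) (I : ideal {mfun T >-> R}).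

Local Notation M := {mfun T >-> R}.
Local Notation on_ZI := (on_conull mu (zero_sets I)).

Definition Linfty_I : set M :=
  [set f : M | on_ZI (fun A => [bounded f x | x in A])].

Definition Imu : set M :=
  [set f : M | forall g : M, on_ZI (fun A => [bounded (f * g) x | x in A])].

Definition Uplus : set M :=
  [set u : M | on_ZI (fun A => forall x, A x -> 0 < u x)].

Definition m_ball (f u : M) : set M :=
  [set g : M | on_ZI (fun A => forall x, A x -> `|g x - f x| < u x)].

(* Adjoining 0 makes this the supremum in [0, +oo], so that the supremum over
   the empty set is 0. *)
Definition sup_dist (A : set T) (f g : M) : \bar R :=
  ereal_sup (0%E |` [set (`|f x - g x|)%:E | x in A]).

Definition U_ball (f : M) (e : R) : set M :=
  [set g : M | on_ZI (fun A => (sup_dist A f g < e%:E)%E)].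

Definition m_base : set (set M) :=
  [set B | exists f u, Uplus u /\ B = m_ball f u].

Definition U_base : set (set M) :=
  [set B | exists f e, 0 < e /\ B = U_ball f e].

Lemma zero_setsT : zero_sets I setT.
Proof.
exists 0; first exact: ideal0.
by apply/seteqP; split => x.
Qed.

Lemma zero_setsI Z1 Z2 :
  zero_sets I Z1 -> zero_sets I Z2 -> zero_sets I (Z1 `&` Z2).
Proof.
move=> [f If <-] [g Ig <-].
exists (f * f + g * g); first by apply: idealD; exact: idealMl.
apply/seteqP; split => x /=; rewrite /zero_set/=.
  move/eqP; rewrite -!expr2 paddr_eq0 ?sqr_ge0// !sqrf_eq0.
  by move=> /andP[/eqP ? /eqP ?].
move=> [fx gx]; change (f x * f x + g x * g x = 0).
by rewrite fx gx !mul0r addr0.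
Qed.

Lemma on_conullT (P : set T -> Prop) : P setT -> on_ZI P.
Proof.
move=> PT; exists setT, set0.
by split; rewrite ?setD0 ?measure0//; exact: zero_setsT.
Qed.

Lemma on_conullS (P Q : set T -> Prop) :
  (forall A, P A -> Q A) -> on_ZI P -> on_ZI Q.
Proof. by move=> PQ [Z [E [? ? ? ? /PQ]]]; exists Z, E. Qed.

Lemma on_conullI (P Q : set T -> Prop) :
  (forall A B, A `<=` B -> P B -> P A) ->
  (forall A B, A `<=` B -> Q B -> Q A) ->
  on_ZI P -> on_ZI Q -> on_ZI (fun A => P A /\ Q A).
Proof.
move=> Pm Qm [Z1 [E1 [FZ1 _ mE1 E10 P1]]] [Z2 [E2 [FZ2 _ mE2 E20 P2]]].
have mZ Z : zero_sets I Z -> measurable Z.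
  move=> [f _ <-]; rewrite (_ : zero_set f = f @^-1` [set 0]).
    by rewrite -[X in measurable X]setTI; exact: measurable_funP.
  by apply/seteqP; split.
have mZ12 : measurable (Z1 `&` Z2) by apply: measurableI; exact: mZ.
exists (Z1 `&` Z2), ((Z1 `&` Z2) `&` (E1 `|` E2)); split.
- exact: zero_setsI.
- exact: subIsetl.
- by apply: measurableI => //; exact: measurableU.
- apply: (subset_measure0 _ _ (@subIsetr _ _ _)) => //.
  + by apply: measurableI => //; exact: measurableU.
  + exact: measurableU.
  + by apply: null_set_setU.
- rewrite setDIr setDv set0U; split.
  + by apply: Pm P1 => x [[Z1x _] /not_orP[]].
  + by apply: Qm P2 => x [[_ Z2x] /not_orP[]].
Qed.

Lemma sup_distP A f g (e : R) : 0 < e ->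
  (sup_dist A f g < e%:E)%E <->
  exists r, [/\ 0 <= r, r < e & forall x, A x -> `|f x - g x| <= r].
Proof.
move=> e0; split=> [se|[r [r0 re Ar]]]; last first.
  apply: (@le_lt_trans _ _ r%:E); last by rewrite lte_fin.
  by apply: ge_ereal_sup => _ [->|[x Ax <-]]; rewrite lee_fin// Ar.
have s0 : (0 <= sup_dist A f g)%E by apply: ereal_sup_ubound; left.
have sr : (sup_dist A f g \is a fin_num)%E.
  by rewrite ge0_fin_numE// (lt_trans se)// ltry.
exists (fine (sup_dist A f g)); split.
- exact: fine_ge0.
- by rewrite -lte_fin fineK.
- move=> x Ax; rewrite -lee_fin fineK//.
  by apply: ereal_sup_ubound; right; exists x.
Qed.

Lemma sup_dist_mono (f g : M) (e : R) (A B : set T) : A `<=` B ->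
  (sup_dist B f g < e%:E)%E -> (sup_dist A f g < e%:E)%E.
Proof.
move=> AB; apply: le_lt_trans; apply: le_ereal_sup => _ [->|[x Ax <-]].
  by left.
by right; exists x => //; exact: AB.
Qed.

Lemma U_ball_shrink f h (e : R) : 0 < e -> U_ball f e h ->
  exists2 e', 0 < e' & U_ball h e' `<=` U_ball f e.
Proof.
move=> e0 [Z [E [FZ EZ mE E0 /sup_distP-/(_ e0)[r [r0 re Ar]]]]].
exists (e - r); first by rewrite subr_gt0.
move=> g hg.
have fh : on_ZI (fun A => forall x, A x -> `|f x - h x| <= r).
  by exists Z, E.
apply: on_conullS (on_conullI _ _ hg fh) => [A [hgA fhA]||].
- have er0 : 0 < e - r by rewrite subr_gt0.
  move: hgA => /sup_distP-/(_ er0)[s [s0 sr hgA]].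
  apply/sup_distP => //; exists (r + s); split; first exact: addr_ge0.
    by rewrite addrC -ltrBrDr.
  move=> x Ax; rewrite (le_trans (ler_distD (h x) _ _))//.
  by apply: lerD; [exact: fhA|exact: hgA].
- by move=> A B; exact: sup_dist_mono.
- by move=> A B AB PB x /AB; exact: PB.
Qed.

Lemma m_ball_shrink f u h : Uplus u -> m_ball f u h ->
  exists2 v, Uplus v & m_ball h v `<=` m_ball f u.
Proof.
move=> u0 fuh.
have mv : measurable_fun setT (fun x => u x - `|h x - f x|).
  apply: measurable_funB => //; apply: measurableT_comp => //.
  exact: measurable_funB.
pose v : M := HB.pack (fun x => u x - `|h x - f x|)
  (isMeasurableFun.Build _ _ _ _ _ mv).
exists v.
  by apply: on_conullS fuh => A hA x /hA; rewrite /v/= subr_gt0.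
move=> g hg; apply: on_conullS hg => A hA x /hA.
rewrite /v/= ltrBrDr; apply: le_lt_trans.
exact: ler_distD.
Qed.

Lemma m_base_cover : \bigcup_(B in m_base) B = setT.
Proof.
apply/seteqP; split => // f _; exists (m_ball f 1).
  by exists f, 1; split => //; apply: on_conullT => x _; exact: (@ltr01 R).
by apply: on_conullT => x _; rewrite subrr normr0; exact: (@ltr01 R).
Qed.

Lemma m_base_join (B1 B2 : set M) (h : M) :
  m_base B1 -> m_base B2 -> B1 h -> B2 h ->
  exists B, [/\ m_base B, B h & B `<=` B1 `&` B2].
Proof.
move=> [f1 [u1 [u10 ->]]] [f2 [u2 [u20 ->]]] h1 h2.
have [v1 v10 s1] := m_ball_shrink u10 h1.
have [v2 v20 s2] := m_ball_shrink u20 h2.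
pose v : M := min_mfun v1 v2.
have vE x : v x = Num.min (v1 x) (v2 x) by [].
have v0 : Uplus v.
  apply: on_conullS (on_conullI _ _ v10 v20) => [A [p q] x Ax||].
  - by rewrite vE lt_min p// q.
  - by move=> A B AB PB x /AB; exact: PB.
  - by move=> A B AB PB x /AB; exact: PB.
exists (m_ball h v); split.
- by exists h, v.
- by apply: on_conullS v0 => A p x /p; rewrite subrr normr0.
- move=> g hg; split.
  + apply: s1; apply: on_conullS hg => A p x /p.
    by rewrite vE lt_min => /andP[].
  + apply: s2; apply: on_conullS hg => A p x /p.
    by rewrite vE lt_min => /andP[].
Qed.

Lemma U_ball_center f (e : R) : 0 < e -> U_ball f e f.
Proof.
move=> e0; apply: on_conullT; apply/sup_distP => //.
by exists 0; split => // x _; rewrite subrr normr0.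
Qed.

Lemma U_base_cover : \bigcup_(B in U_base) B = setT.
Proof.
apply/seteqP; split => // f _; exists (U_ball f 1); last exact: U_ball_center.
by exists f, 1.
Qed.

Lemma U_base_join (B1 B2 : set M) (h : M) :
  U_base B1 -> U_base B2 -> B1 h -> B2 h ->
  exists B, [/\ U_base B, B h & B `<=` B1 `&` B2].
Proof.
move=> [f1 [e1 [e10 ->]]] [f2 [e2 [e20 ->]]] h1 h2.
have [r1 r10 s1] := U_ball_shrink e10 h1.
have [r2 r20 s2] := U_ball_shrink e20 h2.
have r0 : 0 < Num.min r1 r2 by rewrite lt_min r10.
exists (U_ball h (Num.min r1 r2)); split.
- by exists h, (Num.min r1 r2).
- exact: U_ball_center.
- move=> g hg; split.
  + apply: s1; apply: on_conullS hg => A /lt_le_trans; apply.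
    by rewrite lee_fin ge_min lexx.
  + apply: s2; apply: on_conullS hg => A /lt_le_trans; apply.
    by rewrite lee_fin ge_min lexx orbT.
Qed.

End measure_ideal.

#[short(type="topComNzRingType")]
HB.structure Definition TopComNzRing :=
  {A of Topological A & GRing.ComNzRing A}.

(* Neither notion requires the Hausdorff property; the library's [tvsType] is
   not used because it also demands local convexity. *)
Definition topological_ring (A : topComNzRingType) : Prop :=
  [/\ continuous (fun z : A * A => z.1 + z.2),
      continuous (fun x : A => - x) &
      continuous (fun z : A * A => z.1 * z.2)].

Definition topological_vector_space (K : numFieldType)
    (V : preTopologicalLmodType K) : Prop :=
  continuous (fun z : V * V => z.1 + z.2) /\
  continuous (fun z : K^o * V => z.1 *: z.2).

(* Copies of the ring and vector space {mfun T >-> R}, carrying respectively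
   the U_{mu_I}-topology and the m_{mu_I}-topology. *)
Definition U_space d (T : measurableType d) (R : realType)
    (mu : {measure set T -> \bar R}) (I : ideal {mfun T >-> R}) : Type :=
  {mfun T >-> R}.

Definition m_space d (T : measurableType d) (R : realType)
    (mu : {measure set T -> \bar R}) (I : ideal {mfun T >-> R}) : Type :=
  {mfun T >-> R}.

Section instances.
Context d (T : measurableType d) (R : realType).
Variables (mu : {measure set T -> \bar R}) (I : ideal {mfun T >-> R}).

HB.instance Definition _ := GRing.ComNzRing.copy (U_space mu I) {mfun T >-> R}.
HB.instance Definition _ := GRing.Lmodule.copy (U_space mu I) {mfun T >-> R}.
HB.instance Definition _ := isBaseTopological.Build (U_space mu I)
  (U_base_cover mu I) (@U_base_join _ _ _ mu I).

HB.instance Definition _ := GRing.ComNzRing.copy (m_space mu I) {mfun T >-> R}.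
HB.instance Definition _ := GRing.Lmodule.copy (m_space mu I) {mfun T >-> R}.
HB.instance Definition _ := isBaseTopological.Build (m_space mu I)
  (m_base_cover mu I) (@m_base_join _ _ _ mu I).

End instances.

(* Main.v *)
From HB Require Import structures.
Require Import Defs.
From mathcomp Require Import all_boot all_order all_algebra.
From mathcomp Require Import all_classical all_reals all_analysis.
From mathcomp Require Import measurable_realfun ring lra.

Set Implicit Arguments.
Unset Strict Implicit.
Unset Printing Implicit Defensive.

Import Order.TTheory GRing.Theory Num.Theory.
Import numFieldNormedType.Exports.

Local Open Scope classical_set_scope.
Local Open Scope ring_scope.

(** All eight conditions say that every measurable function [f] is bounded
off a null subset of some [Z] in [Z[I]], i.e. that [Linfty_I] is everything;
[mu_stable] is this by definition, and the two conditions on [Imu] reduce to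
it because [f = 1 * f] is bounded as soon as all multiples of [1] are
([Imu1_full_Linfty], [full_Linfty_Imu]).

Boundedness is what the uniform topology needs in order to behave well.
Multiplication is continuous at bounded functions ([U_mul_continuous]), so if
all functions are bounded we get a topological ring, hence a topological
vector space, because constants embed [R] continuously and scaling is
multiplication by a constant ([U_scale_continuous]).  Conversely, if
[a *: f] tends to [0] uniformly as [a] tends to [0], then already one nonzero
[a] makes [a *: f] bounded ([U_vector_space_full_Linfty]).

For connectedness: two functions at finite uniform distance are bounded
together, so [Linfty_I] is always clopen and contains [0]
([U_connected_full_Linfty]); and a topological vector space is a union of
lines through [0] ([U_vector_space_connected]).

For the comparison of the two topologies, the m-topology is always the finer
one, since constants are admissible radii.  A radius [u] that is positive almost
everywhere on some [Z] dominates a constant radius exactly when it is bounded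
below there.  Passing between [u] and [ln u], or between [f] and
[expR (- `|f|)], translates lower bounds for radii into upper bounds for
functions ([U_ball_sub_m_ball], [open_eq_full_Linfty]). *)

Section local_topologies.
Context d (T : measurableType d) (R : realType).
Variables (mu : {measure set T -> \bar R}) (I : ideal {mfun T >-> R}).

Local Notation M := {mfun T >-> R}.

(** * Statements holding almost everywhere on a member of Z[I] *)

(** [on_conull] for conditions tested point by point, the only form in which
it occurs once bounds and uniform distances have been made explicit. *)
Definition ae_on_ZI (p : T -> Prop) :=
  on_conull mu (zero_sets I) (fun A => forall x, A x -> p x).

Lemma ae_on_ZI_impl p q : (forall x, p x -> q x) -> ae_on_ZI p -> ae_on_ZI q.
Proof. by move=> pq; apply: on_conullS => A pA x /pA /pq. Qed.

Lemma ae_on_ZI_and p q r : (forall x, p x -> q x -> r x) ->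
  ae_on_ZI p -> ae_on_ZI q -> ae_on_ZI r.
Proof.
move=> pqr hp hq; apply: on_conullS (on_conullI _ _ hp hq).
- by move=> A [pA qA] x Ax; apply: pqr; [exact: pA|exact: qA].
- by move=> A B AB pB x /AB /pB.
- by move=> A B AB qB x /AB /qB.
Qed.

Lemma ae_on_ZIT (p : T -> Prop) : (forall x, p x) -> ae_on_ZI p.
Proof. by move=> pT; apply: on_conullT => x _. Qed.

(** The general characterization of boundedness by an explicit bound asks for
a proper filter, so for a nonempty [A]; here [A] may well be empty. *)
Lemma bounded_inP (f : T -> R) (A : set T) :
  [bounded f x | x in A] <-> exists K, forall x, A x -> `|f x| <= K.
Proof.
split=> [[K [_ fK]]|[K fK]].
  by exists (K + 1) => x Ax; apply: (fK (K + 1)) Ax; rewrite ltrDl.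
exists K; split=> [|L KL x Ax]; first exact: num_real.
exact: le_trans (fK x Ax) (ltW KL).
Qed.

Lemma Linfty_IP (f : M) :
  Linfty_I mu I f <-> exists K, ae_on_ZI (fun x => `|f x| <= K).
Proof.
split=> [[Z [E [FZ EZ mE E0 /bounded_inP[K fK]]]]|[K]].
  by exists K, Z, E.
by apply: on_conullS => A fK; apply/bounded_inP; exists K.
Qed.

(** * The two topologies near a point *)

(** [U_ball_lt] and [le_U_ball] are used as elimination and introduction rules
in place of the definition.  They are not converse to each other: a pointwise
strict bound does not make the supremum strictly smaller, whence the slack
[r < e] in the second. *)
Lemma U_ball_lt (f g : M) e : 0 < e ->
  U_ball mu I f e g -> ae_on_ZI (fun x => `|f x - g x| < e).
Proof.
move=> e0; apply: on_conullS => A /(sup_distP _ _ _ e0)[r [_ re fg]] x /fg.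
by move=> /le_lt_trans; exact.
Qed.

Lemma le_U_ball (f g : M) r e : r < e -> 0 < e ->
  ae_on_ZI (fun x => `|f x - g x| <= r) -> U_ball mu I f e g.
Proof.
move=> re e0; apply: on_conullS => A fg; apply/sup_distP => //.
(* A bound r valid on an empty set may be negative. *)
exists (Num.max 0 r); split; first by rewrite le_max lexx.
  by rewrite gt_max e0 re.
by move=> x /fg fgx; rewrite le_max fgx orbT.
Qed.

Lemma nbhs_U_spaceP (f : U_space mu I) (A : set (U_space mu I)) :
  nbhs f A <-> exists2 e, 0 < e & U_ball mu I f e `<=` A.
Proof.
split=> [|[e e0 feA]].
  rewrite nbhsE => -[B [[D Dbase <-] [C DC Cf]] DA].
  have [g [r [r0 CE]]] := Dbase _ DC.
  move: Cf; rewrite CE => /(U_ball_shrink r0)[e e0 fegr].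
  by exists e => // h /fegr hC; apply: DA; exists C => //; rewrite CE.
rewrite nbhsE; exists (U_ball mu I f e) => //; split.
  exists [set U_ball mu I f e]; last by rewrite bigcup_set1.
  by move=> _ ->; exists f, e.
exact: U_ball_center.
Qed.

Lemma nbhs_m_spaceP (f : m_space mu I) (A : set (m_space mu I)) :
  nbhs f A <-> exists2 u, Uplus mu I u & m_ball mu I f u `<=` A.
Proof.
split=> [|[u u0 fuA]].
  rewrite nbhsE => -[B [[D Dbase <-] [C DC Cf]] DA].
  have [g [w [w0 CE]]] := Dbase _ DC.
  move: Cf; rewrite CE => /(m_ball_shrink w0)[u u0 fugw].
  by exists u => // h /fugw hC; apply: DA; exists C => //; rewrite CE.
rewrite nbhsE; exists (m_ball mu I f u) => //; split.
  exists [set m_ball mu I f u]; last by rewrite bigcup_set1.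
  by move=> _ ->; exists f, u.
by apply: on_conullS u0 => A0 u0 x /u0; rewrite subrr normr0.
Qed.

Lemma m_ball_sub_U_ball (f : M) e : 0 < e ->
  m_ball mu I f (cst (e / 2)) `<=` U_ball mu I f e.
Proof.
move=> e0 g; rewrite /m_ball /= => fg.
apply: (@le_U_ball _ _ (e / 2)) => //; first lra.
by apply: ae_on_ZI_impl fg => x; rewrite /cst distrC => /ltW.
Qed.

(** A bound [K] for [`|ln u|] gives the lower bound [expR (- K)] for [u].
The logarithm is meaningful only where [u] is positive, but this holds almost
everywhere on a member of [Z[I]]. *)
Lemma U_ball_sub_m_ball (f u : M) : Linfty_I mu I = setT -> Uplus mu I u ->
  exists2 e, 0 < e & U_ball mu I f e `<=` m_ball mu I f u.
Proof.
move=> LT u0.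
have mlnu : measurable_fun setT (@ln R \o u).
  by apply: measurableT_comp => //; exact: measurable_ln.
pose lnu : M := HB.pack (@ln R \o u) (isMeasurableFun.Build _ _ _ _ _ mlnu).
have /Linfty_IP[K lnuK] : Linfty_I mu I lnu by rewrite LT.
have uK : ae_on_ZI (fun x => expR (- K) <= u x).
  apply: ae_on_ZI_and u0 lnuK => x ux0 /ler_normlP[+ _].
  rewrite -[lnu x]/(ln (u x)) => nK.
  by rewrite -[u x]lnK ?posrE// ler_expR lerNl.
exists (expR (- K)); first exact: expR_gt0.
move=> g /(U_ball_lt (expR_gt0 _)) fg.
by apply: ae_on_ZI_and fg uK => x; rewrite distrC; exact: lt_le_trans.
Qed.

(** * Equality of the topologies *)
Lemma full_Linfty_open_eq : Linfty_I mu I = setT ->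
  (@open (U_space mu I) : set (set M)) = @open (m_space mu I).
Proof.
move=> LT; apply/seteqP; split=> A; rewrite !openE => oA f /oA.
- move=> /nbhs_U_spaceP[e e0 feA]; apply/nbhs_m_spaceP.
  exists (cst (e / 2)); last exact: subset_trans (m_ball_sub_U_ball e0) feA.
  by apply: ae_on_ZIT => x; rewrite /cst /=; lra.
- move=> /nbhs_m_spaceP[u u0 fuA]; apply/nbhs_U_spaceP.
  have [e e0 fefu] := U_ball_sub_m_ball f LT u0.
  by exists e => //; exact: subset_trans fuA.
Qed.

(** For the radius [u := expR (- `|f|)], a uniform neighbourhood of [0] inside
[m_ball 0 u] contains a small positive constant; that constant lies below [u],
which bounds [f]. *)
Lemma open_eq_full_Linfty :
  (@open (U_space mu I) : set (set M)) = @open (m_space mu I) ->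
  Linfty_I mu I = setT.
Proof.
move=> UmE; apply/seteqP; split=> // f _.
have mu_ : measurable_fun setT (fun x => expR (- `|f x|)).
  apply: measurableT_comp => //; apply: measurableT_comp => //.
  exact: measurableT_comp.
pose u : M := HB.pack (fun x => expR (- `|f x|))
  (isMeasurableFun.Build _ _ _ _ _ mu_).
have u0 : Uplus mu I u by apply: ae_on_ZIT => x; exact: expR_gt0.
have : nbhs (0 : U_space mu I) (m_ball mu I 0 u).
  have : nbhs (0 : m_space mu I) (m_ball mu I 0 u).
    by apply/nbhs_m_spaceP; exists u.
  rewrite !nbhsE => -[B [oB B0] BS]; exists B => //; split=> //.
  by rewrite UmE.
move=> /nbhs_U_spaceP[e e0 eu].
have /eu e2u : U_ball mu I 0 e (cst (e / 2)).
  apply: (@le_U_ball _ _ (e / 2)) => //; first lra.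
  apply: ae_on_ZIT => x; rewrite /cst /= sub0r normrN ger0_norm//; lra.
apply/Linfty_IP; exists (- ln (e / 2)).
apply: ae_on_ZI_impl e2u => x.
rewrite /cst /= subr0 ger0_norm; last lra.
move=> e2u; rewrite lerNr -ler_expR lnK; first exact: ltW.
by rewrite posrE; lra.
Qed.

(** * Continuity of the operations *)
Lemma U_add_continuous :
  continuous (fun z : U_space mu I * U_space mu I => z.1 + z.2).
Proof.
move=> [f g] A /= /nbhs_U_spaceP[e e0 fgA].
have e4 : 0 < e / 4 by lra.
exists (U_ball mu I f (e / 4), U_ball mu I g (e / 4)) => /=.
  by split; apply/nbhs_U_spaceP; exists (e / 4).
move=> [f' g'] /= [/(U_ball_lt e4) ff' /(U_ball_lt e4) gg'].
apply: fgA; apply: (@le_U_ball _ _ (e / 2)) => //; first lra.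
apply: ae_on_ZI_and ff' gg' => x ff' gg'.
change (`|(f x + g x) - (f' x + g' x)| <= e / 2).
rewrite opprD addrACA (le_trans (ler_normD _ _))//; lra.
Qed.

Lemma U_opp_continuous : continuous (fun f : U_space mu I => - f).
Proof.
move=> f A /= /nbhs_U_spaceP[e e0 fA].
have e2 : 0 < e / 2 by lra.
apply/nbhs_U_spaceP; exists (e / 2) => // g /(U_ball_lt e2) fg.
apply: fA; apply: (@le_U_ball _ _ (e / 2)) => //; first lra.
apply: ae_on_ZI_impl fg => x fg.
change (`|- f x - (- g x)| <= e / 2).
by rewrite -normrN opprD !opprK ltW.
Qed.

Lemma U_mul_continuous : Linfty_I mu I = setT ->
  continuous (fun z : U_space mu I * U_space mu I => z.1 * z.2).
Proof.
move=> LT [f g] A /= /nbhs_U_spaceP[e e0 fgA].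
have /Linfty_IP[K fK] : Linfty_I mu I f by rewrite LT.
have /Linfty_IP[L gL] : Linfty_I mu I g by rewrite LT.
(* With r <= 1 the error is at most |K| r + r (|L| + 1) = r N. *)
pose N := 1 + `|K| + `|L|.
have N0 : 0 < N by rewrite /N; have := normr_ge0 K; have := normr_ge0 L; lra.
pose r := Num.min 1 (e / 2 / N).
have r0 : 0 < r by rewrite lt_min ltr01 !divr_gt0.
have r1 : r <= 1 by rewrite ge_min lexx.
have rN : r * N <= e / 2 by rewrite -ler_pdivlMr// ge_min lexx orbT.
exists (U_ball mu I f r, U_ball mu I g r) => /=.
  by split; apply/nbhs_U_spaceP; exists r.
move=> [f' g'] /= [/(U_ball_lt r0) ff' /(U_ball_lt r0) gg'].
apply: fgA; apply: (@le_U_ball _ _ (e / 2)) => //; first lra.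
have ffK := ae_on_ZI_and (fun x => @conj _ _) ff' fK.
have ggL := ae_on_ZI_and (fun x => @conj _ _) gg' gL.
apply: ae_on_ZI_and ffK ggL => x [ff'x fKx] [gg'x gLx].
change (`|f x * g x - f' x * g' x| <= e / 2).
(* The factor g' is written g - (g - g') to make its bound L + 1 visible. *)
have -> : f x * g x - f' x * g' x =
    f x * (g x - g' x) + (f x - f' x) * (g x - (g x - g' x)) by ring.
rewrite (le_trans _ rN)// (le_trans (ler_normD _ _))// !normrM.
have gN : `|g x - (g x - g' x)| <= `|L| + 1.
  rewrite (le_trans (ler_normB _ _))// lerD//.
    exact: le_trans gLx (ler_norm _).
  exact: ltW (lt_le_trans gg'x r1).
have fN : `|f x| <= `|K| by exact: le_trans fKx (ler_norm _).
rewrite (_ : r * N = `|K| * r + r * (`|L| + 1)); last by rewrite /N; ring.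
by rewrite lerD// ler_pM// ltW.
Qed.

Lemma U_topological_ring : Linfty_I mu I = setT ->
  topological_ring (U_space mu I).
Proof.
move=> LT; split; last exact: U_mul_continuous.
- exact: U_add_continuous.
- exact: U_opp_continuous.
Qed.

(** Constants form a copy of the real line, so scalar multiplication inherits
its continuity from the ring multiplication. *)
Lemma U_cst_continuous : continuous (fun a : R^o => cst a : U_space mu I).
Proof.
move=> a A /= /nbhs_U_spaceP[e e0 aA].
have e2 : 0 < e / 2 by lra.
apply/nbhs_ballP; exists (e / 2) => // b /= ab.
apply: aA; apply: (@le_U_ball _ _ (e / 2)) => //; first lra.
by apply: ae_on_ZIT => x; exact: ltW.
Qed.

Lemma U_scale_continuous : topological_ring (U_space mu I) ->
  continuous (fun z : R^o * U_space mu I => z.1 *: z.2).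
Proof.
move=> [_ _ mulC].
move=> [a f] A /=.
have scaleE b (g : U_space mu I) : b *: g = (cst b : U_space mu I) * g.
  by apply/mfuneqP.
rewrite scaleE => /(mulC (cst a : U_space mu I, f))[[B C] /= [Ba Cf] BCA].
exists ((cst : R^o -> U_space mu I) @^-1` B, C) => /=.
  by split=> //; exact: U_cst_continuous.
move=> [b g] /= [Bb Cg]; rewrite scaleE.
exact: (BCA (cst b : U_space mu I, g)).
Qed.

Lemma U_topological_vector_space : topological_ring (U_space mu I) ->
  topological_vector_space (U_space mu I).
Proof. by split; [exact: U_add_continuous|exact: U_scale_continuous]. Qed.

(** Near [(0, f)] scaling lands within distance [1] of [0], so
[(r / 2) *: f] is bounded for some [r > 0]. *)
Lemma U_vector_space_full_Linfty : topological_vector_space (U_space mu I) ->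
  Linfty_I mu I = setT.
Proof.
move=> [_ scaleC]; apply/seteqP; split=> // f _.
have : nbhs ((0 : R) *: (f : U_space mu I)) (U_ball mu I 0 1).
  by rewrite scale0r; apply/nbhs_U_spaceP; exists 1.
move=> /(scaleC (0, f)) [[B C] /= [B0 Cf] BC].
have [r /= r0 rB] := (nbhs_ballP _ _).1 B0.
have r2 : 0 < r / 2 by lra.
have : U_ball mu I 0 1 ((r / 2) *: (f : U_space mu I)).
  apply: (BC (r / 2, f)); split => /=; last exact: nbhs_singleton Cf.
  by apply: rB; rewrite /ball /= sub0r normrN gtr0_norm//; lra.
move=> /(U_ball_lt ltr01) rf.
apply/Linfty_IP; exists (r / 2)^-1; apply: ae_on_ZI_impl rf => x.
change (`|0 - r / 2 * f x| < 1 -> `|f x| <= (r / 2)^-1).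
rewrite sub0r normrN normrM gtr0_norm// => /ltW.
by rewrite -[(r / 2)^-1]div1r ler_pdivlMr// mulrC.
Qed.

(** * Connectedness *)
Lemma U_vector_space_connected : topological_vector_space (U_space mu I) ->
  connected [set: U_space mu I].
Proof.
move=> [_ scaleC].
have -> : [set: U_space mu I] =
    \bigcup_(f in [set: U_space mu I]) range (fun a : R^o => a *: f).
  apply/seteqP; split=> // f _; exists f => //; exists 1 => //.
  exact: scale1r.
apply: bigcup_connected.
  by exists 0 => f _; exists 0 => //; rewrite scale0r.
move=> f _; apply: connected_continuous_connected.
  by apply/connected_intervalP.
apply: continuous_subspaceT => a.
move=> A /(scaleC (a, f))[[B C] /= [Ba Cf] BCA].
apply: filterS Ba => b Bb; apply: (BCA (b, f)); split=> //=.
exact: nbhs_singleton Cf.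
Qed.

(** Bounded and unbounded functions are never at finite uniform distance; this
makes [Linfty_I] both open and closed. *)
Lemma Linfty_I_U_ball (f g : M) e : 0 < e ->
  U_ball mu I f e g -> Linfty_I mu I f <-> Linfty_I mu I g.
Proof.
move=> e0 /(U_ball_lt e0) fg; split => /Linfty_IP[K hK];
  apply/Linfty_IP; exists (e + K); apply: ae_on_ZI_and fg hK => x /ltW fgx hKx.
- rewrite -[g x](subrK (f x)) (le_trans (ler_normD _ _))//.
  by rewrite lerD// distrC.
- by rewrite -[f x](subrK (g x)) (le_trans (ler_normD _ _))// lerD.
Qed.

Lemma U_connected_full_Linfty : connected [set: U_space mu I] ->
  Linfty_I mu I = setT.
Proof.
move=> Uco; apply: (Uco (Linfty_I mu I)).
- by exists 0; apply/Linfty_IP; exists 0; apply: ae_on_ZIT => x; rewrite normr0.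
- exists (Linfty_I mu I); last by rewrite setTI.
  rewrite openE => f Lf; apply/nbhs_U_spaceP; exists 1 => // g.
  by move=> /(Linfty_I_U_ball ltr01)[+ _]; exact.
- exists (Linfty_I mu I); last by rewrite setTI.
  rewrite -openC openE => f Lf; apply/nbhs_U_spaceP; exists 1 => // g.
  by move=> /(Linfty_I_U_ball ltr01)[_ gf] /gf.
Qed.

(** * Functions all of whose multiples are bounded *)
Lemma Imu1_full_Linfty : Imu mu I 1 -> Linfty_I mu I = setT.
Proof.
move=> I1; apply/seteqP; split=> // f _.
by have := I1 f; rewrite mul1r.
Qed.

Lemma full_Linfty_Imu : Linfty_I mu I = setT -> Imu mu I = setT.
Proof.
move=> LT; apply/seteqP; split=> // f _ g.
by have : Linfty_I mu I (f * g) by rewrite LT.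
Qed.

Lemma mu_stable_full_LinftyP :
  mu_stable mu (zero_sets I) <-> Linfty_I mu I = setT.
Proof.
split=> [st|LT f]; first by apply/seteqP; split=> // f _; exact: st.
by have : Linfty_I mu I f by rewrite LT.
Qed.

End local_topologies.

Theorem theorem3p7 (d : measure_display) (T : measurableType d) (R : realType)
    (mu : {measure set T -> \bar R}) (I : ideal {mfun T >-> R}) :
  [<-> (@open (U_space mu I) : set (set {mfun T >-> R}))
         = @open (m_space mu I);
       topological_ring (U_space mu I);
       topological_vector_space (U_space mu I);
       Linfty_I mu I = [set: {mfun T >-> R}];
       Imu mu I = Linfty_I mu I;
       Imu mu I = [set: {mfun T >-> R}];
       connected [set: U_space mu I];
       mu_stable mu (zero_sets I)].
Proof.
tfae.
- by move=> /open_eq_full_Linfty; exact: U_topological_ring.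
- exact: U_topological_vector_space.
- exact: U_vector_space_full_Linfty.
- by move=> LT; rewrite full_Linfty_Imu.
- move=> IL; apply/full_Linfty_Imu/Imu1_full_Linfty; rewrite IL.
  by apply/Linfty_IP; exists 1; apply: ae_on_ZIT => x; rewrite normr1.
- move=> IT; apply/U_vector_space_connected/U_topological_vector_space.
  by apply/U_topological_ring/Imu1_full_Linfty; rewrite IT.
- by move=> /U_connected_full_Linfty/mu_stable_full_LinftyP.
- by move=> /mu_stable_full_LinftyP; exact: full_Linfty_open_eq.
Qed.
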